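(* Let $n \ge 1$ and $k \ge 0$ be integers. Every tournament on $n$ vertices has at most $$n\left(\frac{n-1}{2}\right)^k$$ walks of length $k$.
   Context: A tournament on $n$ vertices is a directed graph on a set of $n$ vertices, without loops, such that for every two distinct vertices $x,y$ exactly one of the ordered pairs $(x,y)$, $(y,x)$ is a directed edge. A walk of length $k$ is a sequence of vertices $(x_0,x_1,\ldots,x_k)$, not necessarily distinct, such that $(x_{i-1},x_i)$ is a directed edge for each $1\le i\le k$; thus length refers to the number of edges. The number of walks of length $k$ is the number of such sequences. The convention $0^0=1$ is used. *)

(* Defs.v *)
From mathcomp Require Import all_boot all_order all_algebra.

Set Implicit Arguments.
Unset Strict Implicit.
Unset Printing Implicit Defensive.

(* [(+)] is exclusive or: exactly one of the two orientations is an edge. *)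
Definition tournament (T : finType) (e : rel T) : Prop :=
  irreflexive e /\ forall x y : T, x != y -> e x y (+) e y x.

(* The length counts edges, so a walk of length [k] lists [k.+1] vertices
   (possibly repeated); [sorted e] says that consecutive ones are [e]-related. *)
Definition walks (T : finType) (e : rel T) (k : nat) : {set k.+1.-tuple T} :=
  [set w : k.+1.-tuple T | sorted e w].

(* Main.v *)
Require Import Defs.
From mathcomp Require Import all_boot all_order all_algebra.
From mathcomp Require Import ring lra.
Import Order.TTheory GRing.Theory Num.Theory.
Local Open Scope ring_scope.

(** The bound holds for every finite directed graph in which out-degree plus
    in-degree is at most [d] at each vertex, with [d / 2] in place of
    [(n - 1) / 2] ([walks_le]); in a tournament all these sums are [n - 1].

    Let [A] be the adjacency operator, [c = d / 2], and let [f] be any function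
    on the vertices.  Weight the squared norms by degree:
    [O f = \sum_x outdeg x * f x ^ 2] and [I f = \sum_x indeg x * f x ^ 2], so
    that [O f + I f <= 2 * c * |f|^2].  The inequality [2 a b <= a^2 + b^2],
    applied on each edge and summed ([edge_sum_le]), gives
    [2 * <f, A g> <= O f + I g].  Taking [A f] and [c f] for [f] and [g],
    [O (A f) + I (A f) <= 2 * c * |A f|^2 = 2 * <A f, A (c f)>
                       <= O (A f) + c^2 * I f],
    hence [I (A f) <= c^2 * I f] ([in_energy_adj]): although [A] need not
    contract the Euclidean norm by [c], it contracts this weighted one.

    The number of walks of length [l + 1] is [<1, A a>] with [a = A^l 1].
    Using [edge_sum_le] once more, with the constant [c^l] against [a],
    [2 * c^l * <1, A a> <= c^(2l) * O 1 + I a <= c^(2l) * (O 1 + I 1)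
                        <= c^(2l) * (2 * c * n)],
    where now [n] is the number of vertices; dividing by [2 * c^l] gives
    [n * c^(l + 1)].  If [c = 0] there are no edges, and the same estimate with
    [1] in place of the constant [c^l] says so. *)

Section DegreeEnergy.

Variables (R : realFieldType) (T : finType) (e : rel T).
Implicit Types f g : T -> R.

Definition outdeg (x : T) : nat := #|[set y | e x y]|.
Definition indeg (x : T) : nat := #|[set y | e y x]|.

Definition adj f : T -> R := fun x => \sum_(y | e x y) f y.

Definition out_energy f : R := \sum_x (outdeg x)%:R * f x ^+ 2.
Definition in_energy f : R := \sum_x (indeg x)%:R * f x ^+ 2.

(** Summed over the edges, the two squares in [2 a b <= a^2 + b^2] are counted
    once per edge leaving, respectively entering, their vertex. *)
Lemma edge_sum_le f g :
  2 * (\sum_x f x * adj g x) <= out_energy f + in_energy g.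
Proof.
have outE : out_energy f = \sum_x \sum_(y | e x y) f x ^+ 2.
  apply: eq_bigr => x _; rewrite mulr_natl -sumr_const.
  by apply: eq_bigl => y; rewrite inE.
have inE : in_energy g = \sum_x \sum_(y | e x y) g y ^+ 2.
  rewrite (exchange_big_dep predT) //=.
  apply: eq_bigr => y _; rewrite mulr_natl -sumr_const.
  by apply: eq_bigl => x; rewrite inE.
rewrite outE inE -big_split mulr_sumr; apply: ler_sum => x _ /=.
rewrite -big_split /= !mulr_sumr; apply: ler_sum => y _.
rewrite -subr_ge0; have := sqr_ge0 (f x - g y); congr (0 <= _); ring.
Qed.

Variable d : nat.
Hypothesis deg_le : forall x, (outdeg x + indeg x <= d)%N.

Let c : R := d%:R / 2.

Lemma energy_le f : out_energy f + in_energy f <= 2 * c * \sum_x f x ^+ 2.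
Proof.
rewrite -big_split mulr_sumr; apply: ler_sum => x _ /=.
rewrite -mulrDl -natrD ler_wpM2r ?sqr_ge0 //.
by rewrite (_ : 2 * c = d%:R) ?ler_nat // /c; field.
Qed.

(** The out-energy of [adj f] occurs on both sides and cancels, which is why
    only the in-degree weight is contracted. *)
Lemma in_energy_adj f : in_energy (adj f) <= c ^+ 2 * in_energy f.
Proof.
have normE : 2 * c * \sum_x adj f x ^+ 2
           = 2 * \sum_x adj f x * adj (fun y => c * f y) x.
  rewrite -mulrA [c * _]mulr_sumr; congr (2 * _); apply: eq_bigr => x _.
  by rewrite /adj -mulr_sumr; ring.
have scaleE : in_energy (fun y => c * f y) = c ^+ 2 * in_energy f.
  by rewrite mulr_sumr; apply: eq_bigr => x _; ring.
have := energy_le (adj f); rewrite normE => lower.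
have := le_trans lower (edge_sum_le (adj f) (fun y => c * f y)).
by rewrite scaleE lerD2l.
Qed.

Lemma in_energy_iter l f :
  in_energy (iter l adj f) <= c ^+ (2 * l) * in_energy f.
Proof.
elim: l => [|l IHl]; first by rewrite muln0 expr0 mul1r.
rewrite iterS (le_trans (in_energy_adj _)) // mulnS exprD -mulrA.
by rewrite ler_wpM2l ?sqr_ge0.
Qed.

Lemma sum_iter_adj_le k :
  \sum_x iter k adj (fun=> 1) x <= #|T|%:R * c ^+ k.
Proof.
have c_ge0 : 0 <= c by rewrite divr_ge0 ?ler0n.
have sum1T : \sum_(x : T) 1 ^+ 2 = #|T|%:R :> R.
  by rewrite expr1n sumr_const.
case: k => [|l]; first by rewrite /= sumr_const expr0 mulr1.
set one := (fun=> 1) : T -> R; set w := \sum_x _.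
have init : out_energy one + in_energy one <= 2 * c * #|T|%:R.
  by rewrite -sum1T; apply: energy_le.
(* The scale [t] is free; the optimal [c ^+ l] may vanish with [c], and then
   any positive value serves. *)
have weighted t : 2 * (t * w) <= t ^+ 2 * out_energy one
                                 + c ^+ (2 * l) * in_energy one.
  have -> : t * w = \sum_x t * adj (iter l adj one) x by rewrite mulr_sumr.
  apply: le_trans (edge_sum_le (fun=> t) _) _.
  apply: lerD (in_energy_iter l one).
  rewrite mulr_sumr; apply: ler_sum => x _.
  by rewrite expr1n mulr1 mulrC.
have [c0|c_neq0] := eqVneq c 0.
  have O_ge0 : 0 <= out_energy one.
    by apply: sumr_ge0 => x _; rewrite mulr_ge0 ?sqr_ge0.
  have I_ge0 : 0 <= in_energy one.
    by apply: sumr_ge0 => x _; rewrite mulr_ge0 ?sqr_ge0.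
  have := weighted 1; move: init; rewrite c0 mulr0 mul0r => init.
  have -> : out_energy one = 0 by lra.
  have -> : in_energy one = 0 by lra.
  rewrite (exprS 0 l) mul0r !mulr0; lra.
have cl_gt0 : 0 < c ^+ l by rewrite exprn_gt0 // lt_def c_neq0.
have := weighted (c ^+ l); rewrite -exprM mulnC -mulrDr => bound.
have c2l_ge0 : 0 <= c ^+ (2 * l) by rewrite exprn_ge0.
have {}bound := le_trans bound (ler_wpM2l c2l_ge0 init).
rewrite -(ler_pM2l cl_gt0) -(ler_pM2l (ltr0Sn R 1)) (le_trans bound) //.
by rewrite mul2n -addnn exprD exprS le_eqVlt; apply/orP; left; apply/eqP; ring.
Qed.

End DegreeEnergy.

Arguments outdeg {T} e x.
Arguments indeg {T} e x.
Arguments adj {R T} e f x.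

Lemma card_tuple_cons (T : finType) k (P : T -> k.-tuple T -> bool) :
  #|[set s : k.+1.-tuple T | P (thead s) [tuple of behead s]]|
    = (\sum_x #|[set s | P x s]|)%N.
Proof.
under eq_bigr => y _ do rewrite -sum1dep_card.
rewrite -sum1dep_card pair_big_dep /=.
rewrite (reindex (fun p : T * k.-tuple T => [tuple of p.1 :: p.2])) /=.
  by apply: eq_bigl => -[y s] /=; rewrite theadE; congr P; apply: val_inj.
exists (fun s : k.+1.-tuple T => (thead s, [tuple of behead s])).
  by case=> y s _; congr pair; apply: val_inj.
by move=> s _; rewrite /= -tuple_eta.
Qed.

Lemma card_path_tuples (R : realFieldType) (T : finType) (e : rel T) k x :
  #|[set s : k.-tuple T | path e x s]|%:R = iter k (adj e) (fun=> 1) x :> R.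
Proof.
elim: k x => [|k IHk] x.
  rewrite (_ : [set _ | _] = setT) ?cardsT ?card_tuple //.
  by apply/setP => s; rewrite !inE tuple0.
rewrite iterS /adj -(eq_bigr _ (fun y _ => IHk y)) -natr_sum; congr _%:R.
have -> : [set s : k.+1.-tuple T | path e x s]
        = [set s : k.+1.-tuple T | e x (thead s) && path e (thead s) (behead s)].
  by apply/setP => s; rewrite !inE {1}[s]tuple_eta.
rewrite (card_tuple_cons _ _ (fun y s => e x y && path e y s)) [RHS]big_mkcond.
apply: eq_bigr => y _; case: (e x y) => //=.
by apply/eqP; rewrite cards_eq0; apply/eqP/setP => s; rewrite !inE.
Qed.

Lemma card_walks (R : realFieldType) (T : finType) (e : rel T) k :
  #|walks e k|%:R = \sum_x iter k (adj e) (fun=> 1) x :> R.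
Proof.
under eq_bigr => x _ do rewrite -card_path_tuples.
rewrite -natr_sum -(card_tuple_cons _ _ (fun x s => path e x s)); congr _%:R.
by apply: eq_card => s; rewrite !inE {1}[s]tuple_eta.
Qed.

Lemma walks_le (R : realFieldType) (T : finType) (e : rel T) (d k : nat) :
  (forall x, outdeg e x + indeg e x <= d)%N ->
  #|walks e k|%:R <= #|T|%:R * (d%:R / 2) ^+ k :> R.
Proof. by move=> deg_le; rewrite card_walks; apply: sum_iter_adj_le. Qed.

Lemma tournament_deg (T : finType) (e : rel T) x :
  tournament e -> (outdeg e x + indeg e x)%N = #|T|.-1.
Proof.
case=> irr tot; rewrite -(cardsC1 x) -cardsUI.
rewrite (_ : _ :&: _ = set0) ?cards0 ?addn0; last first.
  apply/setP => y; rewrite !inE; have [->|/tot] := eqVneq x y.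
    by rewrite irr.
  by case: (e x y) (e y x) => [] [].
congr #|pred_of_set _|; apply/setP => y; rewrite !inE eq_sym.
have [->|/tot] := eqVneq x y; first by rewrite irr.
by case: (e x y) (e y x) => [] [].
Qed.

Theorem theorem1 (n k : nat) (n_ge1 : (1 <= n)%N)
    (T : finType) (cardT : #|T| = n) (e : rel T) (e_tournament : tournament e) :
  #|walks e k|%:R <= n%:R * ((n%:R - 1) / 2%:R) ^+ k :> rat.
Proof.
have deg_le x : (outdeg e x + indeg e x <= n.-1)%N.
  by rewrite tournament_deg // cardT.
have := walks_le rat T e n.-1 k deg_le.
by rewrite cardT -subn1 natrB.
Qed.
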